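(* In the finite-horizon coordinator problem (P) described in the context, it is without loss of optimality for the coordinator to restrict attention to summary-based strategies $\tilde\phi=(\tilde\phi_t)_{t=1}^T$ of the form $$\tilde\phi_t:\Delta(\mathbb Z)\to\big(\mathbb Z\times\mathcal M\to\Delta(\mathcal A)\big),$$ used through $\phi_t[a^{t-1}](\cdot\mid m^t)=\tilde\phi_t[\eta_t](\cdot\mid n(m^{t-1}),m_t)$; that is, some policy induced by such a $\tilde\phi$ is optimal for (P). Moreover, an optimal strategy $\tilde\phi^*$ can be found from the Bellman equations: with $$\tilde V_T(\eta)=\max_{\tilde\theta\in\tilde S(\eta)}\tilde f^x(\eta,\tilde\theta),\qquad \tilde V_t(\eta)=\max_{\tilde\theta\in\tilde S(\eta)}\Big\{\tilde f^x(\eta,\tilde\theta)+\mathbb E\big[\tilde V_{t+1}(\eta_{t+1})\mid\eta_t=\eta,\tilde\theta_t=\tilde\theta\big]\Big\},\quad t=1,\dots,T-1,$$ any $\tilde\phi^*$ for which $\tilde\phi^*_t[\eta]$ attains the corresponding maximum for all $t$ and $\eta$ induces an optimal policy for (P).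
   Context: Model. Let $p\in(0,1/2)$, $\bar p=1-p$, $\mathcal W=\mathcal Y=\mathcal M=\mathcal A=\{-1,1\}$. $W$ is uniform on $\mathcal W$; given $W=w$, the signals $Y_1,Y_2,\dots$ are i.i.d. with $Q^y(y\mid w)=\bar p$ if $y=w$ and $p$ if $y\ne w$. $\Delta(S)$ denotes the set of probability distributions on $S$; $x^t=(x_1,\dots,x_t)$. For integer $n$ put $q(1\mid n)=\frac{(\bar p/p)^n}{(\bar p/p)^n+1}$, $q(-1\mid n)=\frac{1}{(\bar p/p)^n+1}$, and $n(m^{t-1})=\sum_{\tau=1}^{t-1}m_\tau$ (equal to $0$ for $t=1$). Policies. A partial strategy at time $t$ is a map $\theta_t:\mathcal M^t\to\Delta(\mathcal A)$. A policy is $\phi=(\phi_t)_{t=1}^T$, where $\phi_t$ maps each public action history $a^{t-1}\in\mathcal A^{t-1}$ to a partial strategy $\theta_t=\phi_t[a^{t-1}]$. All agents join the mechanism and report truthfully, $M_t=Y_t$ (agent $t$'s message, seen only by the coordinator); the publicly observed action satisfies $A_t\sim\theta_t(\cdot\mid M^t)$. Public belief. $\pi_1$ is the trivial distribution on the one-point set $\mathcal M^0$, and $\pi_{t+1}=T_t(\pi_t,a_t,\theta_t)$ with $$\pi_{t+1}(m^t)=\frac{\sum_w q(w\mid n(m^{t-1}))\,\pi_t(m^{t-1})\,Q^y(m_t\mid w)\,\theta_t(a_t\mid m^t)}{\sum_{\bar w,\bar m^t} q(\bar w\mid n(\bar m^{t-1}))\,\pi_t(\bar m^{t-1})\,Q^y(\bar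 m_t\mid\bar w)\,\theta_t(a_t\mid\bar m^t)}$$ (when the denominator vanishes, $a_t$ has probability $0$ and any fixed convention may be used). The induced summary belief is $\eta_t\in\Delta(\mathbb Z)$, $\eta_t(n)=\sum_{m^{t-1}:\,n(m^{t-1})=n}\pi_t(m^{t-1})$. Truth-telling. $S_t(\pi)$ is the set of partial strategies $\theta$ such that for both $y\in\{-1,1\}$, $\sum_{w,m^{t-1}}Q^y(y\mid w)q(w\mid n(m^{t-1}))\pi(m^{t-1})\big(\theta(w\mid(m^{t-1},y))-\theta(w\mid(m^{t-1},-y))\big)\ge0$. Tax. $\hat f^x_t(\pi,\theta)=\sum_{y,w,m^{t-1}}Q^y(y\mid w)q(w\mid n(m^{t-1}))\pi(m^{t-1})\big(\theta(w\mid(m^{t-1},y))-\gamma_\pi(w\mid y)\big)$, where $\gamma_\pi(\cdot\mid y)$ is supported on the maximizers over $a\in\mathcal A$ of $Q^y(y\mid a)\sum_{m^{t-1}}q(a\mid n(m^{t-1}))\pi(m^{t-1})$ (the tax does not depend on tie-breaking). Problem (P). Maximize $\mathbb E^\phi\big[\sum_{t=1}^T\hat f^x_t(\pi_t,\theta_t)\big]$ over policies $\phi$ with $\phi_t[a^{t-1}]\in S_t(\pi_t)$ for all $t$ and $a^{t-1}$. Summary-based objects. For $\eta\in\Delta(\mathbb Z)$ and $\tilde\theta:\mathbb Z\times\mathcal M\to\Delta(\mathcal A)$: $\tilde S(\eta)=\{\tilde\theta:\sum_{w,n}Q^y(y\mid w)\eta(n)q(w\mid n)(\tilde\theta(w\mid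 n,y)-\tilde\theta(w\mid n,-y))\ge0\ \ \forall y\}$; $\tilde f^x(\eta,\tilde\theta)=\sum_{y,w,n}Q^y(y\mid w)\eta(n)q(w\mid n)(\tilde\theta(w\mid n,y)-\gamma_\eta(w\mid y))$, with $\gamma_\eta(\cdot\mid y)$ supported on the maximizers over $a$ of $Q^y(y\mid a)\sum_n\eta(n)q(a\mid n)$. Given $\eta_t=\eta$ and $\tilde\theta_t=\tilde\theta$, action $a_t=a$ occurs with probability $\sum_{w,n,m}\eta(n)q(w\mid n)Q^y(m\mid w)\tilde\theta(a\mid n,m)$ and then $\eta_{t+1}=\tilde T(\eta,a,\tilde\theta)$, where $$\tilde T(\eta,a,\tilde\theta)(n')=\frac{\sum_{w}\sum_{m\in\{-1,1\}}\eta(n'-m)\,q(w\mid n'-m)\,Q^y(m\mid w)\,\tilde\theta(a\mid n'-m,m)}{\sum_{w,n,m}\eta(n)\,q(w\mid n)\,Q^y(m\mid w)\,\tilde\theta(a\mid n,m)}.$$ *)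

(* Defs.v *)
From HB Require Import structures.
From mathcomp Require Import all_boot all_order all_algebra.
From mathcomp Require Import all_classical all_reals all_analysis.

Set Implicit Arguments.
Unset Strict Implicit.
Unset Printing Implicit Defensive.

Import Order.TTheory GRing.Theory Num.Theory.

Local Open Scope classical_set_scope.
Local Open Scope ring_scope.

(* Conventions.
   - The alphabets W = Y = M = A = {-1, 1} are all represented by [bool], with
     [true] standing for 1 and [false] for -1; negation of a symbol is [~~].
   - Time is counted from 0: index [t] below is period t + 1, so a history
     x^{t-1} of the period with index [t] is a [t.-tuple bool], listed in
     chronological order, and the periods of the problem are the [t < T].
   - A conditional law k(b | a) is written [k a b], conditioning first, except
     for [Qy] and [q], which keep the order of Q^y(y | w) and q(w | n). *)

Definition sgn (b : bool) : int := if b then 1 else - 1.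

Definition tinit (X : Type) (t : nat) (s : t.+1.-tuple X) : t.-tuple X :=
  [tuple of belast (thead s) (behead s)].

Definition tlast (X : Type) (t : nat) (s : t.+1.-tuple X) : X :=
  tnth s ord_max.

Definition trcons (X : Type) (t : nat) (s : t.-tuple X) (x : X) :
  t.+1.-tuple X := [tuple of rcons s x].

Lemma tinit_rcons (X : Type) (t : nat) (s : t.-tuple X) (x : X) :
  tinit (trcons s x) = s.
Proof.
apply: val_inj => /=; rewrite /thead (tnth_nth x) /=.
by case: (tval s) => [|y s'] //=; rewrite belast_rcons.
Qed.

Lemma tlast_rcons (X : Type) (t : nat) (s : t.-tuple X) (x : X) :
  tlast (trcons s x) = x.
Proof. by rewrite /tlast (tnth_nth x) /= nth_rcons size_tuple ltnn eqxx. Qed.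

Definition msum (t : nat) (m : t.-tuple bool) : int := \sum_(x <- m) sgn x.

Definition is_max {R : realType} (A : set R) (v : R) : Prop :=
  A v /\ ubound A v.

Definition fin_dist {R : realType} (S : finType) (f : S -> R) : Prop :=
  (forall s, 0 <= f s) /\ \sum_s f s = 1.

Definition Z_dist {R : realType} (f : int -> R) : Prop :=
  (forall n, 0 <= f n) /\ (\esum_(n in [set: int]) (f n)%:E = 1)%E.

(* Sum over Z of an absolutely summable family. Every family summed below is a
   distribution on Z times a bounded function, so both parts are finite. *)
Definition Zsum {R : realType} (f : int -> R) : R :=
  fine (\esum_(n in [set: int]) (Num.max (f n) 0)%:E)%E
  - fine (\esum_(n in [set: int]) (Num.max (- f n) 0)%:E)%E.

Section Model.
Context {R : realType} (p : R).

Definition Qy (y w : bool) : R := if y == w then 1 - p else p.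

Definition q (w : bool) (n : int) : R :=
  if w then ((1 - p) / p) ^ n / (((1 - p) / p) ^ n + 1)
  else 1 / (((1 - p) / p) ^ n + 1).

Definition strategy (t : nat) := t.+1.-tuple bool -> bool -> R.

Definition is_strategy (t : nat) (theta : strategy t) : Prop :=
  forall m, fin_dist (theta m).

Definition policy := forall t : nat, t.-tuple bool -> strategy t.

(* A choice of the value of T_t(pi, a, theta) when its denominator vanishes. *)
Definition convention :=
  forall t : nat, (t.-tuple bool -> R) -> bool -> strategy t ->
    t.+1.-tuple bool -> R.

Definition is_convention (conv : convention) : Prop :=
  forall t (pi : t.-tuple bool -> R) a (theta : strategy t),
    fin_dist pi -> is_strategy theta -> fin_dist (conv t pi a theta).

Definition update_num (t : nat) (pi : t.-tuple bool -> R) (a : bool)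
    (theta : strategy t) (m : t.+1.-tuple bool) : R :=
  \sum_(w : bool) q w (msum (tinit m)) * pi (tinit m) * Qy (tlast m) w
                  * theta m a.

Definition update (conv : convention) (t : nat) (pi : t.-tuple bool -> R)
    (a : bool) (theta : strategy t) : t.+1.-tuple bool -> R :=
  let den := \sum_(m : t.+1.-tuple bool) update_num pi a theta m in
  if den == 0 then conv t pi a theta
  else fun m => update_num pi a theta m / den.

Fixpoint belief (conv : convention) (phi : policy) (t : nat) :
    t.-tuple bool -> t.-tuple bool -> R :=
  match t with
  | 0 => fun _ _ => 1
  | s.+1 => fun a =>
      update conv (belief conv phi (tinit a)) (tlast a) (phi s (tinit a))
  end.

Definition summary (t : nat) (pi : t.-tuple bool -> R) (n : int) : R :=
  \sum_(m : t.-tuple bool | msum m == n) pi m.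

Definition truthful (t : nat) (pi : t.-tuple bool -> R) (theta : strategy t) :
    Prop :=
  forall y : bool,
    0 <= \sum_(w : bool) \sum_(m : t.-tuple bool)
           Qy y w * q w (msum m) * pi m
           * (theta (trcons m y) w - theta (trcons m (~~ y)) w).

(* [gam t pi y w] stands for gamma_pi(w | y), with arbitrary tie-breaking. *)
Definition response :=
  forall t : nat, (t.-tuple bool -> R) -> bool -> bool -> R.

Definition best_response (gam : response) : Prop :=
  forall t (pi : t.-tuple bool -> R) (y : bool), fin_dist pi ->
    fin_dist (gam t pi y) /\
    forall a b : bool, gam t pi y a != 0 ->
      Qy y b * \sum_(m : t.-tuple bool) q b (msum m) * pi m
      <= Qy y a * \sum_(m : t.-tuple bool) q a (msum m) * pi m.

Definition tax (gam : response) (t : nat) (pi : t.-tuple bool -> R)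
    (theta : strategy t) : R :=
  \sum_(y : bool) \sum_(w : bool) \sum_(m : t.-tuple bool)
    Qy y w * q w (msum m) * pi m * (theta (trcons m y) w - gam t pi y w).

(* Joint law of (W, M^t, A^t) under [phi], with truthful reports M = Y. *)
Fixpoint law (phi : policy) (t : nat) :
    bool -> t.-tuple bool -> t.-tuple bool -> R :=
  match t with
  | 0 => fun _ _ _ => 1 / 2
  | s.+1 => fun w m a =>
      law phi w (tinit m) (tinit a) * Qy (tlast m) w
      * phi s (tinit a) m (tlast a)
  end.

Fixpoint total_tax (gam : response) (conv : convention) (phi : policy)
    (t : nat) : t.-tuple bool -> R :=
  match t with
  | 0 => fun _ => 0
  | s.+1 => fun a =>
      total_tax gam conv phi (tinit a)
      + tax gam (belief conv phi (tinit a)) (phi s (tinit a))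
  end.

Definition objective (gam : response) (conv : convention) (T : nat)
    (phi : policy) : R :=
  \sum_(w : bool) \sum_(m : T.-tuple bool) \sum_(a : T.-tuple bool)
    law phi w m a * total_tax gam conv phi a.

Definition feasible (conv : convention) (T : nat) (phi : policy) : Prop :=
  forall t, (t < T)%N -> forall a : t.-tuple bool,
    is_strategy (phi t a) /\ truthful (belief conv phi a) (phi t a).

Definition optimal (gam : response) (conv : convention) (T : nat)
    (phi : policy) : Prop :=
  feasible conv T phi /\
  forall phi' : policy, feasible conv T phi' ->
    objective gam conv T phi' <= objective gam conv T phi.

Definition sstrategy := int -> bool -> bool -> R.

Definition is_sstrategy (theta : sstrategy) : Prop :=
  forall n y, fin_dist (theta n y).

Definition spolicy := nat -> (int -> R) -> sstrategy.

Definition is_spolicy (T : nat) (phi : spolicy) : Prop :=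
  forall t, (t < T)%N -> forall eta, Z_dist eta -> is_sstrategy (phi t eta).

Definition lift_strategy (t : nat) (theta : sstrategy) : strategy t :=
  fun m => theta (msum (tinit m)) (tlast m).

(* The beliefs and the policy generated by [phi] have to be built together,
   since eta_t depends on the partial strategies used before t;
   [induced_beliefE] identifies these beliefs with those of the policy. *)
Fixpoint induced_belief (conv : convention) (phi : spolicy) (t : nat) :
    t.-tuple bool -> t.-tuple bool -> R :=
  match t with
  | 0 => fun _ _ => 1
  | s.+1 => fun a =>
      let pi := induced_belief conv phi (tinit a) in
      update conv pi (tlast a) (lift_strategy (phi s (summary pi)))
  end.

Definition induced_policy (conv : convention) (phi : spolicy) : policy :=
  fun t a => lift_strategy (phi t (summary (induced_belief conv phi a))).

Lemma induced_beliefE (conv : convention) (phi : spolicy) (t : nat)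
    (a : t.-tuple bool) :
  belief conv (induced_policy conv phi) a = induced_belief conv phi a.
Proof. by elim: t a => [//|t IH] a /=; rewrite IH. Qed.

Lemma inducedE (conv : convention) (phi : spolicy) (t : nat)
    (a : t.-tuple bool) (m : t.+1.-tuple bool) :
  induced_policy conv phi a m =
  phi t (summary (belief conv (induced_policy conv phi) a))
    (msum (tinit m)) (tlast m).
Proof. by rewrite induced_beliefE. Qed.

Definition struthful (eta : int -> R) : set sstrategy :=
  [set theta | is_sstrategy theta /\ forall y : bool,
     0 <= Zsum (fun n => \sum_(w : bool)
            Qy y w * eta n * q w n * (theta n y w - theta n (~~ y) w))].

Definition sresponse := (int -> R) -> bool -> bool -> R.

Definition sbest_response (gam : sresponse) : Prop :=
  forall (eta : int -> R) (y : bool), Z_dist eta ->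
    fin_dist (gam eta y) /\
    forall a b : bool, gam eta y a != 0 ->
      Qy y b * Zsum (fun n => eta n * q b n)
      <= Qy y a * Zsum (fun n => eta n * q a n).

Definition stax (gam : sresponse) (eta : int -> R) (theta : sstrategy) :
    R :=
  \sum_(y : bool) \sum_(w : bool)
    Zsum (fun n => Qy y w * eta n * q w n * (theta n y w - gam eta y w)).

Definition saction_prob (eta : int -> R) (theta : sstrategy) (a : bool) : R :=
  \sum_(w : bool) \sum_(m : bool)
    Zsum (fun n => eta n * q w n * Qy m w * theta n m a).

(* If [a] has probability 0 this is the zero function; in [bellman_rhs] it is
   then weighted by 0. *)
Definition supdate (eta : int -> R) (a : bool) (theta : sstrategy) (n : int) :
    R :=
  (\sum_(w : bool) \sum_(m : bool)
     eta (n - sgn m) * q w (n - sgn m) * Qy m w * theta (n - sgn m) m a)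
  / saction_prob eta theta a.

Definition bellman_rhs (gam : sresponse) (T : nat)
    (V : nat -> (int -> R) -> R) (t : nat) (eta : int -> R)
    (theta : sstrategy) : R :=
  if (t.+1 < T)%N then
    stax gam eta theta
    + \sum_(a : bool)
        saction_prob eta theta a * V t.+1 (supdate eta a theta)
  else stax gam eta theta.

Definition bellman (gam : sresponse) (T : nat)
    (V : nat -> (int -> R) -> R) : Prop :=
  forall t, (t < T)%N -> forall eta, Z_dist eta ->
    is_max [set bellman_rhs gam T V t eta theta | theta in struthful eta]
           (V t eta).

Definition attains_bellman (gam : sresponse) (T : nat)
    (V : nat -> (int -> R) -> R) (phi : spolicy) : Prop :=
  forall t, (t < T)%N -> forall eta, Z_dist eta ->
    struthful eta (phi t eta) /\
    bellman_rhs gam T V t eta (phi t eta) = V t eta.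

End Model.

(* Main.v *)
(* All reward-relevant quantities depend on the public belief pi and on the
   partial strategy theta only through the summary eta of pi and the average
   theta~(a | n, y) of theta(a | m, y) over the fibre {m : n(m) = n} under pi;
   this uses that q(w | n) Q^y(m | w) factors as q(w | n + m) times a term free
   of w, so that the law of (W, M^t) given a^t is q(w | n(m)) pi_t(m). Hence the
   tax, the truth-telling constraint and the transition of eta under theta are
   those of the summary problem under theta~, and a telescoping sum over time
   bounds the objective by the Bellman value at eta_1, with equality for a policy
   attaining the maxima.
   The maxima exist because the finite-horizon summary problem from a given eta
   maximises a continuous function over a closed set of plans, a plan being a
   point of the Tychonoff cube indexed by future histories, integers and signals.
   Working with unnormalised measures makes everything positively homogeneous,
   and the division in the update of eta disappears. *)

Require Import Defs.
From HB Require Import structures.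
From mathcomp Require Import all_boot all_order all_algebra.
From mathcomp Require Import all_classical all_reals all_analysis.
From mathcomp Require Import finmap ring lra.

Set Implicit Arguments.
Unset Strict Implicit.
Unset Printing Implicit Defensive.

Import Order.TTheory GRing.Theory Num.Theory.
Import numFieldNormedType.Exports.

Local Open Scope classical_set_scope.
Local Open Scope ring_scope.

(* MathComp-Analysis uses [msum] for sums of measures. *)
Local Notation msum := Defs.msum.

(** * Pointwise operations on continuous real functions *)

Section RealContinuity.
Context {R : realType} {E : topologicalType}.

Lemma continuous_mulr (f g : E -> R) :
  continuous f -> continuous g -> continuous (fun x => f x * g x).
Proof. by move=> cf cg x; apply: cvgM; [exact: cf|exact: cg]. Qed.

Lemma continuous_addr (f g : E -> R) :
  continuous f -> continuous g -> continuous (fun x => f x + g x).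
Proof. by move=> cf cg x; apply: cvgD; [exact: cf|exact: cg]. Qed.

Lemma continuous_oppr (f : E -> R) : continuous f -> continuous (fun x => - f x).
Proof. by move=> cf x; apply: cvgN; exact: cf. Qed.

Lemma continuous_maxr (f g : E -> R) : continuous f -> continuous g ->
  continuous (fun x => Num.max (f x) (g x)).
Proof.
by move=> cf cg x; apply: (@continuous_max R E f g x); [exact: cf|exact: cg].
Qed.

Lemma continuous_minr (f g : E -> R) : continuous f -> continuous g ->
  continuous (fun x => Num.min (f x) (g x)).
Proof.
by move=> cf cg x; apply: (@continuous_min R E f g x); [exact: cf|exact: cg].
Qed.

Lemma continuous_sumr (I : Type) (s : seq I)
    (F : I -> E -> R) :
  (forall i, continuous (F i)) -> continuous (fun x => \sum_(i <- s) F i x).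
Proof. by move=> cF; apply: continuous_big => //; exact: add_continuous. Qed.

End RealContinuity.

(** * Sums over the integers *)

Section IntegerSums.
Context {R : realType}.
Implicit Types (f g h b : int -> R) (c : R).

Definition Zsummable f : Prop :=
  (\esum_(n in [set: int]) `|f n|%:E < +oo)%E.

(** Meaningful for nonnegative summable families only, since [fine] sends an infinite sum to 0. *)
Definition pos_sum f : R := fine (\esum_(n in [set: int]) (f n)%:E)%E.

Lemma ZsumE f :
  Zsum f = pos_sum (fun n => Num.max (f n) 0)
           - pos_sum (fun n => Num.max (- f n) 0).
Proof. by []. Qed.

(** [esum] is a supremum over finite sets, and each finite set is enumerated by a duplicate-free
    sequence; [seq_le_esum] is the converse bound. *)
Lemma esum_seq_le f (M : \bar R) :
  (forall s : seq int, uniq s -> ((\sum_(n <- s) f n)%:E <= M)%E) ->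
  (\esum_(n in [set: int]) (f n)%:E <= M)%E.
Proof.
move=> fM; apply: ge_ereal_sup => _ [A [finA _] <-].
by rewrite fsbig_finite//= sumEFin; apply: fM; exact: fset_uniq.
Qed.

Lemma seq_le_esum f (s : seq int) : uniq s ->
  ((\sum_(n <- s) f n)%:E <= \esum_(n in [set: int]) (f n)%:E)%E.
Proof.
move=> us; apply: esum_ge; exists [set` s]; first by split => //; exact: finite_seq.
by rewrite -fsbig_seq//= sumEFin.
Qed.

Lemma Zsummable_dom f g :
  (forall n, `|f n| <= g n) -> Zsummable g -> Zsummable f.
Proof.
move=> fg; apply: le_lt_trans; apply: le_esum => n _.
by rewrite lee_fin (le_trans (fg n))// ler_norm.
Qed.


Lemma Zsummable0 : Zsummable (fun _ : int => 0 : R).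
Proof. by rewrite /Zsummable esum1// => n _; rewrite normr0. Qed.

Lemma ZsummableD f g :
  Zsummable f -> Zsummable g -> Zsummable (fun n => f n + g n).
Proof.
move=> sf sg; rewrite /Zsummable.
apply: (@le_lt_trans _ _
  (\esum_(n in [set: int]) (`|f n|%:E + `|g n|%:E))%E).
  by apply: le_esum => n _; rewrite lee_fin ler_normD.
by rewrite esumD// lte_add_pinfty.
Qed.

Lemma ZsummableZ c f : Zsummable f -> Zsummable (fun n => c * f n).
Proof.
move=> sf; have sf' : (\esum_(n in [set: int]) `|f n|%:E \is a fin_num)%E.
  by rewrite ge0_fin_numE// esum_ge0.
rewrite /Zsummable; apply: (@le_lt_trans _ _
   (`|c| * fine (\esum_(n in [set: int]) `|f n|%:E))%:E)%E; last first.
  exact: ltry.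
apply: esum_seq_le => s us; rewrite lee_fin.
under eq_bigr do rewrite normrM.
rewrite -mulr_sumr ler_wpM2l// -lee_fin fineK//.
exact: (seq_le_esum (fun n => `|f n|)).
Qed.

Lemma ZsummableN f : Zsummable f -> Zsummable (fun n => - f n).
Proof.
by move=> /(ZsummableZ (-1)); congr Zsummable; apply/funext => n; rewrite mulN1r.
Qed.

Lemma Zsummable_sum (I : Type) (s : seq I) (P : pred I) (F : I -> int -> R) :
  (forall i, Zsummable (F i)) -> Zsummable (fun n => \sum_(i <- s | P i) F i n).
Proof.
move=> sF; elim: s => [|i s IH].
  by under eq_fun do rewrite big_nil; exact: Zsummable0.
under eq_fun do rewrite big_cons.
by case: (P i) => //; exact: ZsummableD.
Qed.

Lemma Zsummable_pos_sum f :
  (forall n, 0 <= f n) -> Zsummable f ->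
  (\esum_(n in [set: int]) (f n)%:E)%E = (pos_sum f)%:E.
Proof.
move=> f0 sf; rewrite /pos_sum fineK// ge0_fin_numE//; last first.
  by apply: esum_ge0 => n _; rewrite lee_fin.
apply: le_lt_trans sf; apply: le_esum => n _.
by rewrite lee_fin ler_norm.
Qed.

Lemma pos_sumD f g : (forall n, 0 <= f n) -> (forall n, 0 <= g n) ->
  Zsummable f -> Zsummable g ->
  pos_sum (fun n => f n + g n) = pos_sum f + pos_sum g.
Proof.
move=> f0 g0 sf sg; apply: EFin_inj; rewrite EFinD -!Zsummable_pos_sum//.
- by rewrite -esumD// => n _; rewrite lee_fin.
- by move=> n; rewrite addr_ge0.
- exact: ZsummableD.
Qed.

Lemma pos_part_summable f : Zsummable f -> Zsummable (fun n => Num.max (f n) 0).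
Proof.
apply: le_lt_trans; apply: le_esum => n _.
by rewrite lee_fin; case: (leP (f n) 0) => _; rewrite ?normr0.
Qed.

Lemma neg_part_summable f :
  Zsummable f -> Zsummable (fun n => Num.max (- f n) 0).
Proof. by move=> /ZsummableN; exact: pos_part_summable. Qed.

(** The positive and negative parts may be replaced by any nonnegative summable decomposition
    [g - h]: sum the identity between the positive part plus [h] and [g] plus the negative part.
    Additivity of [Zsum] follows. *)
Lemma Zsum_diff f g h : (forall n, 0 <= g n) -> (forall n, 0 <= h n) ->
  Zsummable g -> Zsummable h -> (forall n, f n = g n - h n) ->
  Zsum f = pos_sum g - pos_sum h.
Proof.
move=> g0 h0 sg sh fE.
have sf : Zsummable f.
  by rewrite (funext fE); apply: ZsummableD => //; exact: ZsummableN.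
have m0 (x : R) : 0 <= Num.max x 0 by rewrite le_max lexx orbT.
have : pos_sum (fun n => Num.max (f n) 0 + h n) =
       pos_sum (fun n => g n + Num.max (- f n) 0).
  congr pos_sum; apply/funext => n; rewrite fE.
  by case: (leP (g n - h n) 0) => gh; case: (leP (- (g n - h n)) 0) => gh'; lra.
have sp := pos_part_summable sf; have sn := neg_part_summable sf.
by rewrite !pos_sumD// ZsumE; lra.
Qed.

Lemma Zsum_pos f : (forall n, 0 <= f n) -> Zsummable f -> Zsum f = pos_sum f.
Proof.
move=> f0 sf; rewrite (@Zsum_diff f f (fun=> 0))//.
- by rewrite [pos_sum (fun=> 0)]/pos_sum esum1// subr0.
- exact: Zsummable0.
- by move=> n; rewrite subr0.
Qed.

Lemma ZsumD f g : Zsummable f -> Zsummable g ->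
  Zsum (fun n => f n + g n) = Zsum f + Zsum g.
Proof.
move=> sf sg.
have m0 (x : R) : 0 <= Num.max x 0 by rewrite le_max lexx orbT.
have pp := pos_part_summable; have np := neg_part_summable.
rewrite (@Zsum_diff _ (fun n => Num.max (f n) 0 + Num.max (g n) 0)
   (fun n => Num.max (- f n) 0 + Num.max (- g n) 0)).
- rewrite !ZsumE !pos_sumD//; first (by lra); by auto.
- by move=> n; rewrite addr_ge0.
- by move=> n; rewrite addr_ge0.
- by apply: ZsummableD; auto.
- by apply: ZsummableD; auto.
move=> n; case: (leP (f n) 0) => ?; case: (leP (- f n) 0) => ?;
 case: (leP (g n) 0) => ?; case: (leP (- g n) 0) => ?; lra.
Qed.

Lemma ZsumN f : Zsummable f -> Zsum (fun n => - f n) = - Zsum f.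
Proof.
move=> sf; rewrite !ZsumE opprB.
by under [in X in _ - X]eq_fun do rewrite opprK.
Qed.

Lemma Zsum0 : Zsum (fun _ => 0 : R) = 0.
Proof. by rewrite ZsumE oppr0 subrr. Qed.

Lemma Zsum_ge0 f : (forall n, 0 <= f n) -> Zsummable f -> 0 <= Zsum f.
Proof.
move=> f0 sf; rewrite Zsum_pos// -lee_fin -Zsummable_pos_sum//.
by apply: esum_ge0 => n _; rewrite lee_fin.
Qed.

Lemma Zsum_le f g : Zsummable f -> Zsummable g -> (forall n, f n <= g n) ->
  Zsum f <= Zsum g.
Proof.
move=> sf sg fg; rewrite -subr_ge0 -ZsumN// -ZsumD//; last exact: ZsummableN.
by apply: Zsum_ge0 => [n|]; [rewrite subr_ge0|apply/ZsummableD/ZsummableN].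
Qed.

Lemma ler_norm_Zsum f g : Zsummable g -> (forall n, `|f n| <= g n) ->
  `|Zsum f| <= Zsum g.
Proof.
move=> sg fg; have sf := Zsummable_dom fg sg.
rewrite ler_norml -ZsumN//; apply/andP; split; apply: Zsum_le => //.
- exact: ZsummableN.
- by move=> n; have := fg n; rewrite ler_norml => /andP[].
- by move=> n; have := fg n; rewrite ler_norml => /andP[].
Qed.

Lemma ZsumZ c f : Zsummable f -> Zsum (fun n => c * f n) = c * Zsum f.
Proof.
move=> sf.
(* Only the inequality [<=] needs finite subsums; applied to [c^-1] it gives [>=]. *)
have le a g : 0 <= a -> (forall n, 0 <= g n) -> Zsummable g ->
    Zsum (fun n => a * g n) <= a * Zsum g.
  move=> a0 g0 sg; rewrite !Zsum_pos//; last 2 first.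
  - by move=> n; exact: mulr_ge0.
  - exact: ZsummableZ.
  rewrite -lee_fin -Zsummable_pos_sum//; last 2 first.
  - by move=> n; exact: mulr_ge0.
  - exact: ZsummableZ.
  apply: esum_seq_le => s us; rewrite -mulr_sumr lee_fin ler_wpM2l//.
  by rewrite -lee_fin -Zsummable_pos_sum//; exact: seq_le_esum.
have eq a g : 0 <= a -> (forall n, 0 <= g n) -> Zsummable g ->
    Zsum (fun n => a * g n) = a * Zsum g.
  rewrite le_eqVlt => /predU1P[<- g0 sg|a0 g0 sg].
    by under eq_fun do rewrite mul0r; rewrite mul0r Zsum0.
  apply/eqP; rewrite eq_le (le _ _ (ltW a0))//= -ler_pdivlMl//.
  have -> : g = (fun n => a^-1 * (a * g n)).
    by apply/funext => n; rewrite mulKf// gt_eqF.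
  under [in leRHS]eq_fun do rewrite mulKf ?gt_eqF//.
  apply: le; first by rewrite invr_ge0 ltW.
    by move=> n; rewrite mulr_ge0// ltW.
  exact: ZsummableZ.
have eq' g : (forall n, 0 <= g n) -> Zsummable g ->
    Zsum (fun n => c * g n) = c * Zsum g.
  move=> g0 sg; case: (leP 0 c) => c0; first exact: eq.
  have nc0 : 0 <= - c by rewrite oppr_ge0 ltW.
  rewrite -[RHS]opprK -mulNr -eq//.
  rewrite -ZsumN; last by apply: ZsummableZ.
  by congr Zsum; apply/funext => n; rewrite mulNr opprK.
have m0 (x : R) : 0 <= Num.max x 0 by rewrite le_max lexx orbT.
have sp := pos_part_summable sf; have sn := neg_part_summable sf.
rewrite [in RHS]ZsumE -!Zsum_pos// mulrBr -!eq'// -ZsumN; last exact: ZsummableZ.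
rewrite -ZsumD; last 2 first.
- exact: ZsummableZ.
- by apply/ZsummableN/ZsummableZ.
congr Zsum; apply/funext => n; rewrite -mulrBr; congr (_ * _).
by case: (leP (f n) 0) => ?; case: (leP (- f n) 0) => ?; lra.
Qed.

Lemma Zsum_sum (I : Type) (s : seq I) (P : pred I) (F : I -> int -> R) :
  (forall i, Zsummable (F i)) ->
  Zsum (fun n => \sum_(i <- s | P i) F i n) = \sum_(i <- s | P i) Zsum (F i).
Proof.
move=> sF; elim: s => [|i s IH].
  by rewrite big_nil; under eq_fun do rewrite big_nil; exact: Zsum0.
rewrite big_cons; under eq_fun do rewrite big_cons.
case: (P i) => //; rewrite ZsumD// ?IH//; exact: Zsummable_sum.
Qed.

Lemma Zsummable_point c (k : int) :
  Zsummable (fun n => if k == n then c else 0).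
Proof.
rewrite /Zsummable; apply: (@le_lt_trans _ _ (`|c|%:E)); last exact: ltry.
apply: (esum_seq_le (f := fun n => `|if k == n then c else 0|)) => s us.
rewrite lee_fin (eq_bigr (fun n => if k == n then `|c| else 0)); last first.
  by move=> n _; case: ifP => //; rewrite normr0.
case: (boolP (k \in s)) => ks.
  by rewrite (bigD1_seq k)//= eqxx big1 ?addr0// => n; rewrite eq_sym => /negbTE->.
by rewrite big_seq big1// => n ns; case: eqP => // kn; rewrite kn ns in ks.
Qed.

Lemma Zsum_point c (k : int) : Zsum (fun n => if k == n then c else 0) = c.
Proof.
(* Homogeneity reduces a mass of arbitrary sign to the nonnegative unit mass, where [Zsum] is a
   plain [esum]. *)
suff H : Zsum (fun n => if k == n then 1 else 0) = 1 :> R.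
  have := ZsumZ c (@Zsummable_point 1 k); rewrite H mulr1 => {2}<-.
  by congr Zsum; apply/funext => n; case: ifP; rewrite ?mulr1 ?mulr0.
have n0 n : 0 <= (if k == n then 1 else 0) :> R by case: ifP.
rewrite Zsum_pos//; last exact: Zsummable_point.
apply: EFin_inj; rewrite -Zsummable_pos_sum//; last exact: Zsummable_point.
have e0 n : ((if k == n then 1 else 0 : R)%:E >= 0)%E by rewrite lee_fin.
rewrite (esumID [set k])//; rewrite !setTI esum_set1//= eqxx.
rewrite esum1 ?adde0// => n /= nk.
by rewrite ifN//; apply/eqP => kn; apply: nk.
Qed.

Lemma Zsummable_fibers (S : finType) (k : S -> int) (F : S -> R) :
  Zsummable (fun n => \sum_(s | k s == n) F s).
Proof.
under eq_fun do rewrite big_mkcond/=.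
by apply: Zsummable_sum => s; exact: Zsummable_point.
Qed.

(** The bridge from sums over integers to sums over histories: grouping by fibres makes the family a
    finite sum of point masses. *)
Lemma Zsum_fibers (S : finType) (k : S -> int) (F : S -> R) g :
  (forall n, g n = \sum_(s | k s == n) F s) -> Zsum g = \sum_s F s.
Proof.
move=> /funext ->; under eq_fun do rewrite big_mkcond/=.
rewrite Zsum_sum; last by move=> s; exact: Zsummable_point.
by apply: eq_bigr => s _; exact: Zsum_point.
Qed.

Lemma set_bij_shift (k : int) :
  set_bij [set: int] [set: int] (fun n => n - k).
Proof.
split=> //; first by move=> ? ? _ _; exact: addIr.
by move=> n _; exists (n + k) => //; rewrite addrK.
Qed.

Lemma Zsummable_shift (k : int) f : Zsummable f -> Zsummable (fun n => f (n - k)).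
Proof.
by rewrite /Zsummable (reindex_esum _ _ _ _ (set_bij_shift k)).
Qed.

Lemma Zsum_shift (k : int) f : Zsum (fun n => f (n - k)) = Zsum f.
Proof.
rewrite /Zsum; congr (fine _ - fine _);
by rewrite [in RHS](reindex_esum _ _ _ _ (set_bij_shift k)).
Qed.

Lemma Zsum_eq0 f : (forall n, 0 <= f n) -> Zsummable f -> Zsum f = 0 ->
  forall n, f n = 0.
Proof.
move=> f0 sf f_eq0 n; apply/eqP; rewrite eq_le f0 andbT -f_eq0.
rewrite -{1}(Zsum_point (f n) n); apply: Zsum_le => //.
  exact: Zsummable_point.
by move=> k; case: eqP => [->|].
Qed.

Lemma Z_distP f :
  Z_dist f <-> [/\ forall n, 0 <= f n, Zsummable f & Zsum f = 1].
Proof.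
split=> [[f0 f1]|[f0 sf f1]].
  have sf : Zsummable f.
    rewrite /Zsummable (eq_esum (b := fun n => (f n)%:E)) ?f1 ?ltry//.
    by move=> n _; rewrite ger0_norm.
  by split=> //; rewrite Zsum_pos// /pos_sum f1.
by split=> //; rewrite Zsummable_pos_sum// -Zsum_pos// f1.
Qed.

(** A finite set whose partial sum is within [e] of the supremum leaves a tail smaller than [e]. *)
Lemma Zsum_tail b e : (forall n, 0 <= b n) -> Zsummable b -> 0 < e ->
  exists s : seq int, Zsum (fun n => if n \in s then 0 else b n) < e.
Proof.
move=> b0 sb e0.
have fin : (\esum_(n in [set: int]) (b n)%:E \is a fin_num)%E.
  by rewrite Zsummable_pos_sum.
have [_ [A [finA _] <-]] := ub_ereal_sup_adherent e0 fin.
rewrite -/(esum _ _) Zsummable_pos_sum// fsbig_finite//= sumEFin -EFinB lte_fin.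
set s := (X in \sum_(_ <- X) _) => hs; exists s.
have us : uniq s by exact: fset_uniq.
have sin : Zsummable (fun n => \sum_(i <- s) if i == n then b i else 0).
  by apply: Zsummable_sum => i; exact: Zsummable_point.
have inE n : (if n \in s then 0 else b n) =
    b n - \sum_(i <- s) if i == n then b i else 0.
  case: ifPn => ns.
    by rewrite (bigD1_seq n)//= eqxx big1 ?addr0 ?subrr// => i /negbTE->.
  by rewrite big_seq big1 ?subr0// => i si; case: eqP => // ni; rewrite -ni si in ns.
under eq_fun do rewrite inE.
rewrite ZsumD// ?ZsumN//; last exact: ZsummableN.
rewrite Zsum_sum; last by move=> i; exact: Zsummable_point.
under eq_bigr do rewrite Zsum_point.
by rewrite Zsum_pos//; lra.
Qed.

(** Weierstrass test: outside a finite set the dominating family leaves less than [e / 3] uniformly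
    in the parameter, and a finite sum of continuous functions remains. *)
Lemma continuous_Zsum (E : topologicalType) (F : E -> int -> R) b :
  (forall n, continuous (F ^~ n)) -> (forall x n, `|F x n| <= b n) ->
  Zsummable b -> continuous (fun x => Zsum (F x)).
Proof.
move=> cF Fb sb x; apply/cvgrPdist_lt => e e0.
have b0 n : 0 <= b n by exact: le_trans (Fb x n).
have e3 : 0 < e / 3 by lra.
have [s hs] := Zsum_tail b0 sb e3.
pose G y n := if n \in s then 0 else F y n.
have tail_summable : Zsummable (fun n => if n \in s then 0 else b n).
  by apply: Zsummable_dom sb => n; case: ifP => _; rewrite ?normr0 ?ger0_norm//.
have Gb y n : `|G y n| <= if n \in s then 0 else b n.
  by rewrite /G; case: ifP => _; rewrite ?normr0.
have sG y : Zsummable (G y) by exact: Zsummable_dom (Gb y) _.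
have Gle y : `|Zsum (G y)| < e / 3.
  by apply: le_lt_trans hs; exact: ler_norm_Zsum.
(* The finite part is written as a sum of point masses so that additivity applies; [undup] guards
   against repetitions in [s]. *)
have FE y : Zsum (F y) = \sum_(i <- undup s) F y i + Zsum (G y).
  transitivity
    (Zsum (fun n => (\sum_(i <- undup s) if i == n then F y i else 0) + G y n)).
    congr Zsum; apply/funext => n; rewrite /G; case: ifPn => ns.
      rewrite (bigD1_seq n) ?mem_undup ?undup_uniq//= eqxx big1 ?addr0//.
      by move=> i /negbTE->.
    rewrite big_seq big1 ?add0r// => i; rewrite mem_undup => si.
    by case: eqP => // ni; rewrite -ni si in ns.
  rewrite ZsumD//; last by apply: Zsummable_sum => i; exact: Zsummable_point.
  rewrite Zsum_sum; last by move=> i; exact: Zsummable_point.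
  by under eq_bigr do rewrite Zsum_point.
have : continuous (fun y => \sum_(i <- undup s) F y i).
  by exact: continuous_sumr.
move=> /(_ x) /cvgrPdist_lt /(_ _ e3); apply: filterS => y hy.
rewrite !FE; move: hy (Gle x) (Gle y); rewrite !ltr_norml.
by move=> /andP[? ?] /andP[? ?] /andP[? ?]; apply/andP; split; lra.
Qed.

End IntegerSums.

(** * The summary problem for unnormalised measures *)

Section SummaryModel.
Context {R : realType} (p : R) (hp0 : 0 < p) (hp1 : p < 1 / 2).
Implicit Types (mu eta : int -> R) (theta : @sstrategy R) (n : int) (c : R).

Lemma fin_dist_bool (f : bool -> R) :
  fin_dist f <-> [/\ 0 <= f true, 0 <= f false & f true + f false = 1].
Proof.
rewrite /fin_dist big_bool; split=> [[f0 f1]|[ft ff f1]]; first by split.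
by split=> // -[].
Qed.

Lemma fin_dist_le1 (f : bool -> R) a : fin_dist f -> 0 <= f a <= 1.
Proof. by move=> /fin_dist_bool[]; case: a => *; apply/andP; split; lra. Qed.

Lemma Qy_bounds y w : 0 <= Qy p y w <= 1.
Proof.
by move: hp0 hp1 => ? ?; rewrite /Qy; case: ifP => _; apply/andP; split; lra.
Qed.

Lemma Qy_sum w : \sum_y Qy p y w = 1.
Proof. by rewrite big_bool /Qy; case: w => /=; lra. Qed.

Lemma odds_gt0 n : 0 < ((1 - p) / p) ^ n.
Proof. by move: hp0 hp1 => ? ?; apply: exprz_gt0; apply: divr_gt0 => //; lra. Qed.

Lemma q_sum n : \sum_w q p w n = 1.
Proof.
by rewrite big_bool /q /= -mulrDl divff// gt_eqF// addr_gt0// odds_gt0.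
Qed.

Lemma q_ge0 w n : 0 <= q p w n.
Proof.
have r0 := odds_gt0 n.
by rewrite /q; case: w; apply: divr_ge0; lra.
Qed.

Lemma q_bounds w n : 0 <= q p w n <= 1.
Proof.
apply: (@fin_dist_le1 (q p ^~ n)).
by split; [move=> v; exact: q_ge0|exact: q_sum].
Qed.

(** Bayes' rule: a signal [y] multiplies the odds of the state by [r] or by its inverse, that is,
    shifts the exponent by [sgn y]. The remaining factor, the probability of [y], is free of [w]. *)
Lemma q_bayes w y n :
  q p w n * Qy p y w = q p w (n + sgn y) * \sum_v q p v n * Qy p y v.
Proof.
move: hp0 hp1 => lp0 lp1; have p0 : p != 0 by rewrite gt_eqF.
have p1 : 1 - p != 0 by apply/eqP => ?; lra.
have r0 := odds_gt0 n.
rewrite big_bool /q /Qy /=; set r := (1 - p) / p in r0 *.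
have rE : r ^ (n + sgn y) = r ^ n * (if y then r else r^-1).
  rewrite expfzDr; last by rewrite /r mulf_neq0// invr_eq0.
  by case: y.
rewrite rE; clear rE; set x := r ^ n in r0 *; rewrite /r; clearbody x.
have x1 : x + 1 != 0 by apply/eqP => ?; lra.
have q1 : x * (1 - p) + p != 0.
  by apply/eqP => ?; have : 0 < x * (1 - p); [apply: mulr_gt0; lra|lra].
have q2 : x * p + (1 - p) != 0.
  by apply/eqP => ?; have : 0 < x * p; [apply: mulr_gt0; lra|lra].
by case: w; case: y => /=; field; rewrite ?x1 ?p0 ?p1 ?q1 ?q2.
Qed.

Definition Zmeasure mu : Prop := (forall n, 0 <= mu n) /\ Zsummable mu.

Lemma Z_dist_measure mu : Z_dist mu -> Zmeasure mu.
Proof. by move=> /Z_distP[]. Qed.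

Lemma Zmeasure_scale c mu : 0 <= c -> Zmeasure mu -> Zmeasure (fun n => c * mu n).
Proof.
by move=> c0 [mu0 smu]; split=> [n|]; [exact: mulr_ge0|exact: ZsummableZ].
Qed.

(** The numerator of [supdate]: the joint mass of action [a] and next summary [n], left undivided so
    that it is linear in [mu]. *)
Definition action_mass mu (a : bool) theta n : R :=
  \sum_(w : bool) \sum_(m : bool)
    mu (n - sgn m) * q p w (n - sgn m) * Qy p m w * theta (n - sgn m) m a.

Definition peak mu (y w : bool) : R := Qy p y w * Zsum (fun n => mu n * q p w n).

(** The tax with the best response averaged out into a maximum, hence independent of tie-breaking
    and positively homogeneous in [mu]. *)
Definition reward mu theta : R :=
  \sum_(y : bool) \sum_(w : bool)
    Zsum (fun n => Qy p y w * mu n * q p w n * theta n y w)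
  - \sum_(y : bool) Num.max (peak mu y true) (peak mu y false).

Definition slack mu theta (y : bool) : R :=
  Zsum (fun n => \sum_(w : bool)
          Qy p y w * mu n * q p w n * (theta n y w - theta n (~~ y) w)).

Lemma weight_bounds (x a b c : R) :
  0 <= x -> 0 <= a <= 1 -> 0 <= b <= 1 -> 0 <= c <= 1 ->
  0 <= x * a * b * c <= x.
Proof.
move=> x0 /andP[a0 a1] /andP[b0 b1] /andP[c0 c1].
rewrite !mulr_ge0//= -!mulrA ler_piMr//.
by rewrite mulr_ile1 ?mulr_ge0// mulr_ile1.
Qed.

Lemma norm_weight_le (x z a b c : R) :
  0 <= x <= z -> 0 <= a <= 1 -> 0 <= b <= 1 -> 0 <= c <= 1 ->
  `|x * a * b * c| <= z.
Proof.
move=> /andP[x0 xz] a1 b1 c1.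
by have /andP[? ?] := weight_bounds x0 a1 b1 c1; rewrite ger0_norm// (le_trans _ xz).
Qed.

Lemma action_weight_bounds mu theta w m a n (b : int -> R) :
  (forall k, 0 <= mu k <= b k) -> is_sstrategy theta ->
  `|mu n * q p w n * Qy p m w * theta n m a| <= b n.
Proof.
move=> mub th; apply: norm_weight_le => //; first exact: q_bounds.
- exact: Qy_bounds.
- exact: fin_dist_le1.
Qed.

Lemma Zsummable_action_weight mu theta w m a :
  Zmeasure mu -> is_sstrategy theta ->
  Zsummable (fun n => mu n * q p w n * Qy p m w * theta n m a).
Proof.
move=> [mu0 smu] th; apply: Zsummable_dom smu => n.
by apply: action_weight_bounds => // k; rewrite mu0 lexx.
Qed.

Lemma action_mass_measure mu a theta :
  Zmeasure mu -> is_sstrategy theta -> Zmeasure (action_mass mu a theta).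
Proof.
move=> mmu th; split=> [n|].
  apply: sumr_ge0 => w _; apply: sumr_ge0 => m _.
  have /andP[q0 _] := q_bounds w (n - sgn m).
  have /andP[Q0 _] := Qy_bounds m w.
  have /andP[t0 _] := fin_dist_le1 a (th (n - sgn m) m).
  by rewrite !mulr_ge0//; exact: mmu.1.
apply: Zsummable_sum => w; apply: Zsummable_sum => m.
apply: (@Zsummable_shift _ (sgn m)
    (fun n => mu n * q p w n * Qy p m w * theta n m a)).
exact: Zsummable_action_weight.
Qed.

Lemma saction_probE mu a theta :
  Zmeasure mu -> is_sstrategy theta ->
  saction_prob p mu theta a = Zsum (action_mass mu a theta).
Proof.
move=> mmu th; rewrite /saction_prob /action_mass.
have sw w m : Zsummable (fun n =>
    mu (n - sgn m) * q p w (n - sgn m) * Qy p m w * theta (n - sgn m) m a).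
  apply: (@Zsummable_shift _ (sgn m)
    (fun n => mu n * q p w n * Qy p m w * theta n m a)).
  exact: Zsummable_action_weight.
rewrite Zsum_sum; last by move=> w; exact: Zsummable_sum.
apply: eq_bigr => w _; rewrite Zsum_sum//; apply: eq_bigr => m _.
by rewrite -(Zsum_shift (sgn m)).
Qed.

Lemma action_massZ c mu a theta :
  action_mass (fun n => c * mu n) a theta = fun n => c * action_mass mu a theta n.
Proof.
apply/funext => n; rewrite /action_mass mulr_sumr; apply: eq_bigr => w _.
by rewrite mulr_sumr; apply: eq_bigr => m _; rewrite !mulrA.
Qed.

Lemma Zsummable_q mu w : Zmeasure mu -> Zsummable (fun n => mu n * q p w n).
Proof.
move=> [mu0 smu]; apply: Zsummable_dom smu => n.
have /andP[q0 q1] := q_bounds w n.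
by rewrite ger0_norm ?mulr_ge0// ler_piMr.
Qed.

Lemma Zsummable_reward mu theta y w v : Zmeasure mu -> is_sstrategy theta ->
  Zsummable (fun n => Qy p y w * mu n * q p w n * theta n v w).
Proof.
move=> [mu0 smu] th; apply: Zsummable_dom smu => n.
rewrite (mulrC _ (mu n)).
apply: norm_weight_le; rewrite ?mu0 ?lexx//.
- exact: Qy_bounds.
- exact: q_bounds.
- exact: fin_dist_le1.
Qed.

Lemma peakZ c mu y w : Zmeasure mu -> peak (fun n => c * mu n) y w = c * peak mu y w.
Proof.
move=> mmu; rewrite /peak mulrCA -[in RHS]ZsumZ; last exact: Zsummable_q.
by congr (_ * Zsum _); apply/funext => n; rewrite mulrA.
Qed.

Lemma rewardZ c mu theta : 0 <= c -> Zmeasure mu -> is_sstrategy theta ->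
  reward (fun n => c * mu n) theta = c * reward mu theta.
Proof.
move=> c0 mmu th; rewrite /reward mulrBr !mulr_sumr; congr (_ - _).
  apply: eq_bigr => y _; rewrite mulr_sumr; apply: eq_bigr => w _.
  rewrite -ZsumZ; last exact: Zsummable_reward.
  by congr Zsum; apply/funext => n; rewrite !mulrA (mulrC _ c).
by apply: eq_bigr => y _; rewrite !peakZ// maxr_pMr.
Qed.

Lemma Zsummable_slack mu theta y : Zmeasure mu -> is_sstrategy theta ->
  Zsummable (fun n => \sum_(w : bool)
          Qy p y w * mu n * q p w n * (theta n y w - theta n (~~ y) w)).
Proof.
move=> mmu th; apply: Zsummable_sum => w.
under eq_fun do rewrite mulrBr.
by apply/ZsummableD/ZsummableN; exact: Zsummable_reward.
Qed.

Lemma slackZ c mu theta y : Zmeasure mu -> is_sstrategy theta ->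
  slack (fun n => c * mu n) theta y = c * slack mu theta y.
Proof.
move=> mmu th; rewrite /slack -ZsumZ; last exact: Zsummable_slack.
congr Zsum; apply/funext => n; rewrite mulr_sumr; apply: eq_bigr => w _.
by rewrite !mulrA (mulrC _ c).
Qed.

(** A law carried by the maximizers of [f] averages [f] to its maximum, however ties are broken. *)
Lemma sum_argmax (f g : bool -> R) :
  fin_dist g -> (forall a b, g a != 0 -> f b <= f a) ->
  \sum_w g w * f w = Num.max (f true) (f false).
Proof.
move=> /fin_dist_bool[gt gf g1] gmax; rewrite big_bool /=.
case: (leP (f true) (f false)) => [ft|ff].
  have [g0|/(gmax _ false) ft'] := eqVneq (g true) 0.
    by rewrite g0 mul0r add0r (_ : g false = 1) ?mul1r//; lra.
  have -> : f true = f false by apply/eqP; rewrite eq_le ft ft'.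
  by rewrite -mulrDl g1 mul1r.
have [g0|/(gmax _ true)] := eqVneq (g false) 0; last by lra.
by rewrite g0 mul0r addr0 (_ : g true = 1) ?mul1r//; lra.
Qed.

Lemma stax_reward (gam : @sresponse R) eta theta :
  sbest_response p gam -> Z_dist eta -> is_sstrategy theta ->
  stax p gam eta theta = reward eta theta.
Proof.
move=> hgam deta th; have meta := Z_dist_measure deta.
(* Viewing the best response as a strategy constant in [n] lets the summability lemma for rewards
   cover it too. *)
have gdist : is_sstrategy (fun _ : int => gam eta).
  by move=> n z; exact: (hgam eta z deta).1.
rewrite /stax /reward -sumrB; apply: eq_bigr => y _.
have [gd gmax] := hgam eta y deta.
rewrite -(sum_argmax (g := gam eta y))// -sumrB; apply: eq_bigr => w _.
under eq_fun do rewrite mulrBr.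
have sg := Zsummable_reward y w y meta gdist.
rewrite ZsumD ?ZsumN//; [|exact: Zsummable_reward|exact: ZsummableN].
congr (_ - _); rewrite /peak mulrA -ZsumZ; last exact: Zsummable_q.
by congr Zsum; apply/funext => n; ring.
Qed.

(** * Continuity of the one-stage quantities under a uniform summable bound *)

Section Continuity.
Context (E : topologicalType) (mu : E -> int -> R) (theta : E -> @sstrategy R)
  (b : int -> R).
Context (mu_cont : forall n, continuous (mu ^~ n))
  (mu_bound : forall x n, 0 <= mu x n <= b n) (sb : Zsummable b)
  (theta_cont : forall n y w, continuous (fun x => theta x n y w))
  (theta_strategy : forall x, is_sstrategy (theta x)).

Lemma continuous_action_mass a n :
  continuous (fun x => action_mass (mu x) a (theta x) n).
Proof.
apply: continuous_sumr => w; apply: continuous_sumr => m.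
apply: continuous_mulr => //; do 2 (apply: continuous_mulr; last exact: cst_continuous).
exact: mu_cont.
Qed.

(** The probability factors are at most 1, so a summable bound on [mu] yields one on the next
    measure, again uniform in the parameter; the domination hypothesis thus survives each stage. *)
Lemma action_mass_bound x a n :
  0 <= action_mass (mu x) a (theta x) n <= \sum_(w : bool) \sum_m b (n - sgn m).
Proof.
have mmu : Zmeasure (mu x).
  split=> [k|]; first by case/andP: (mu_bound x k).
  by apply: Zsummable_dom sb => k; case/andP: (mu_bound x k) => ? ?; rewrite ger0_norm.
have [-> _] := action_mass_measure a mmu (theta_strategy x).
rewrite /=; apply: ler_sum => w _; apply: ler_sum => m _.
apply: le_trans (ler_norm _) _; exact: action_weight_bounds.
Qed.

Lemma Zsummable_action_mass_bound :
  Zsummable (fun n => \sum_(w : bool) \sum_m b (n - sgn m)).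
Proof.
apply: Zsummable_sum => w; apply: Zsummable_sum => m; exact: Zsummable_shift.
Qed.

Lemma continuous_reward_term y w v : continuous (fun x =>
  Zsum (fun n => Qy p y w * mu x n * q p w n * theta x n v w)).
Proof.
apply: (@continuous_Zsum _ _ _ b) => // [n|x n].
  apply: continuous_mulr => //; apply: continuous_mulr; last exact: cst_continuous.
  by apply: continuous_mulr => //; exact: cst_continuous.
rewrite (mulrC _ (mu x n)).
apply: norm_weight_le => //; last exact/fin_dist_le1/theta_strategy.
- exact: Qy_bounds.
- exact: q_bounds.
Qed.

Lemma continuous_peak y w : continuous (fun x => peak (mu x) y w).
Proof.
apply: continuous_mulr; first exact: cst_continuous.
apply: (@continuous_Zsum _ _ _ b) => // [n|x n].
  by apply: continuous_mulr => //; exact: cst_continuous.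
have /andP[q0 q1] := q_bounds w n; have /andP[m0 mb] := mu_bound x n.
by rewrite ger0_norm ?mulr_ge0// (le_trans _ mb)// ler_piMr.
Qed.

Lemma continuous_reward : continuous (fun x => reward (mu x) (theta x)).
Proof.
apply: continuous_addr.
  apply: continuous_sumr => y; apply: continuous_sumr => w.
  exact: continuous_reward_term.
apply: continuous_oppr; apply: continuous_sumr => y.
by apply: continuous_maxr; exact: continuous_peak.
Qed.

Lemma continuous_slack y : continuous (fun x => slack (mu x) (theta x) y).
Proof.
apply: (@continuous_Zsum _ _ _ (fun n => \sum_(w : bool) (b n + b n))) => [n|x n|].
- apply: continuous_sumr => w; apply: continuous_mulr.
    apply: continuous_mulr; last exact: cst_continuous.
    by apply: continuous_mulr => //; exact: cst_continuous.
  by apply: continuous_addr => //; exact: continuous_oppr.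
- apply: le_trans (ler_norm_sum _ _ _) _; apply: ler_sum => w _.
  rewrite mulrBr (le_trans (ler_normB _ _))//.
  rewrite (mulrC _ (mu x n)).
  apply: lerD; (apply: norm_weight_le => //; last exact/fin_dist_le1/theta_strategy);
  by [exact: q_bounds|exact: Qy_bounds].
- by apply: Zsummable_sum => w; exact: ZsummableD.
Qed.

End Continuity.

(** * Plans and the Bellman equation *)

(* A plan prescribes a summary-based strategy after every sequence of future
   actions: [P (h, n, y)] is the probability of the action [true] after [h]. *)
Definition plan : Type := prod_topology (fun _ : seq bool * int * bool => R).

Definition clamp (x : R) : R := Num.max 0 (Num.min 1 x).

(* Clamping makes [plan_now] a strategy, continuous in the plan, on the whole
   product space. *)
Definition plan_now (P : plan) : @sstrategy R := fun n y w =>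
  if w then clamp (P ([::], n, y)) else 1 - clamp (P ([::], n, y)).

Definition plan_next (P : plan) (a : bool) : plan :=
  fun i => P (a :: i.1.1, i.1.2, i.2).

Fixpoint plan_value (k : nat) mu (P : plan) : R :=
  if k is j.+1 then
    reward mu (plan_now P)
    + \sum_(a : bool)
        plan_value j (action_mass mu a (plan_now P)) (plan_next P a)
  else 0.

Fixpoint plan_feasible (k : nat) mu (P : plan) : Prop :=
  if k is j.+1 then
    (forall y, 0 <= slack mu (plan_now P) y) /\
    forall a : bool,
      plan_feasible j (action_mass mu a (plan_now P)) (plan_next P a)
  else True.

(** The Tychonoff cube: compact, and large enough to hold every plan made of probabilities. *)
Definition unit_plan : set plan := [set P | forall i, `[0, 1]%classic (P i)].

Lemma clamp_bounds (x : R) : 0 <= clamp x <= 1.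
Proof. by rewrite /clamp le_max lexx/= ge_max ler01/= ge_min lexx. Qed.

Lemma clamp_id (x : R) : 0 <= x <= 1 -> clamp x = x.
Proof. by move=> /andP[x0 x1]; rewrite /clamp (min_idPr x1) (max_idPr x0). Qed.

Lemma plan_now_strategy P : is_sstrategy (plan_now P).
Proof.
move=> n y; apply/fin_dist_bool; rewrite /plan_now.
by have /andP[? ?] := clamp_bounds (P ([::], n, y)); split; lra.
Qed.

(** * Continuity of values and closedness of constraints over plans *)

Section PlanContinuity.
Context (E : topologicalType).

Lemma continuous_plan_now (P : E -> plan) n y w :
  (forall i, continuous (fun x => P x i)) ->
  continuous (fun x => plan_now (P x) n y w).
Proof.
move=> cP; have cc : continuous (fun x => clamp (P x ([::], n, y))).
  apply: continuous_maxr; first exact: cst_continuous.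
  by apply: continuous_minr => //; exact: cst_continuous.
case: w => //; apply: continuous_addr; first exact: cst_continuous.
exact: continuous_oppr.
Qed.

(** The measure must vary with the parameter along with the plan: after one stage, [action_mass]
    depends on the plan even if the initial measure does not. *)
Lemma continuous_plan_value k (mu : E -> int -> R) (P : E -> plan) b :
  (forall n, continuous (mu ^~ n)) -> (forall x n, 0 <= mu x n <= b n) ->
  Zsummable b -> (forall i, continuous (fun x => P x i)) ->
  continuous (fun x => plan_value k (mu x) (P x)).
Proof.
elim: k mu P b => [|k IH] mu P b cmu mub sb cP; first exact: cst_continuous.
have cnow n y w := continuous_plan_now (n := n) (y := y) (w := w) cP.
have snow x := plan_now_strategy (P x).
apply: continuous_addr; first exact: (continuous_reward cmu mub sb cnow snow).
apply: continuous_sumr => a.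
apply: (IH _ _ (fun n => \sum_(w : bool) \sum_m b (n - sgn m))).
- by move=> n; exact: (continuous_action_mass cmu cnow).
- by move=> x n; exact: (action_mass_bound mub sb snow).
- exact: Zsummable_action_mass_bound.
- by move=> i; exact: cP.
Qed.

Lemma closed_forall (I : Type) (A : I -> set E) :
  (forall i, closed (A i)) -> closed [set x | forall i, A i x].
Proof.
move=> cA; rewrite (_ : [set x | _] = \bigcap_i A i); first exact: closed_bigI.
by apply/seteqP; split=> x Ax i; [move=> _|]; exact: Ax.
Qed.

Lemma closed_plan_feasible k (mu : E -> int -> R) (P : E -> plan) b :
  (forall n, continuous (mu ^~ n)) -> (forall x n, 0 <= mu x n <= b n) ->
  Zsummable b -> (forall i, continuous (fun x => P x i)) ->
  closed [set x | plan_feasible k (mu x) (P x)].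
Proof.
elim: k mu P b => [|k IH] mu P b cmu mub sb cP; first exact: closedT.
have cnow n y w := continuous_plan_now (n := n) (y := y) (w := w) cP.
have snow x := plan_now_strategy (P x).
apply: closedI; apply: closed_forall => a.
  apply: (preimage_closed (f := fun x => slack (mu x) (plan_now (P x)) a)
    (D := [set r | 0 <= r])); last exact: closed_ge.
  by move=> x _; exact: (continuous_slack cmu mub sb cnow snow).
apply: (IH _ _ (fun n => \sum_(w : bool) \sum_m b (n - sgn m))).
- by move=> n; exact: (continuous_action_mass cmu cnow).
- by move=> x n; exact: (action_mass_bound mub sb snow).
- exact: Zsummable_action_mass_bound.
- by move=> i; exact: cP.
Qed.

End PlanContinuity.

Lemma plan_valueZ k c mu P : 0 <= c -> Zmeasure mu ->
  plan_value k (fun n => c * mu n) P = c * plan_value k mu P.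
Proof.
move=> c0; elim: k mu P => [|k IH] mu P mmu /=; first by rewrite mulr0.
have th := plan_now_strategy P.
rewrite rewardZ// [RHS]mulrDr [in RHS]mulr_sumr; congr (_ + _); apply: eq_bigr => a _.
by rewrite action_massZ IH//; exact: action_mass_measure.
Qed.

(** The slacks are homogeneous, so a strictly positive factor keeps their signs; a zero factor would
    make every plan feasible. *)
Lemma plan_feasibleZ k c mu P : 0 < c -> Zmeasure mu ->
  plan_feasible k (fun n => c * mu n) P <-> plan_feasible k mu P.
Proof.
move=> c0; elim: k mu P => [//|k IH] mu P mmu /=.
have th := plan_now_strategy P.
have sE y : (0 <= slack (fun n => c * mu n) (plan_now P) y) =
            (0 <= slack mu (plan_now P) y) by rewrite slackZ// pmulr_rge0.
by split=> -[sl fe]; split=> [y|a]; [rewrite -sE| |rewrite sE|];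
  rewrite // ?action_massZ; have /IH := action_mass_measure a mmu th;
  have := fe a; rewrite ?action_massZ => H H'; apply/H'.
Qed.

(** A plan that ignores the signal has zero slack, so the feasible set is nonempty. *)
Lemma uniform_feasible k mu : plan_feasible k mu (fun=> 1 / 2).
Proof.
elim: k mu => [//|k IH] mu; split=> [y|a]; last exact: IH.
rewrite /slack (_ : (fun n => _) = (fun=> 0)) ?Zsum0//.
by apply/funext => n; rewrite big1// => w _; rewrite subrr mulr0.
Qed.

Definition optimal_plan (k : nat) mu : set plan := [set P |
  [/\ unit_plan P, plan_feasible k mu P &
      forall P', unit_plan P' -> plan_feasible k mu P' ->
        plan_value k mu P' <= plan_value k mu P]].

(** Extreme value theorem on the intersection of the compact cube with the closed feasible set. *)
Lemma exists_optimal_plan k mu : Zmeasure mu -> exists P, optimal_plan k mu P.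
Proof.
move=> [mu0 smu].
have cP i : continuous (fun P : plan => P i) by exact: proj_continuous.
have cmu n : continuous (fun _ : plan => mu n) by exact: cst_continuous.
have mub (x : plan) n : 0 <= mu n <= mu n by rewrite mu0 lexx.
have cF := closed_plan_feasible (k := k) cmu mub smu cP.
have cV := continuous_plan_value (k := k) cmu mub smu cP.
have cU : compact unit_plan.
  apply: (@tychonoff _ (fun=> R) (fun=> `[0, 1]%classic)) => i.
  exact: segment_compact.
have [|P] := compact_EVT_max _ (compact_closedI cU cF) (continuous_subspaceT cV).
  exists (fun=> 1 / 2); split; last exact: uniform_feasible.
  by move=> i; rewrite /= in_itv/=; apply/andP; split; lra.
rewrite in_setE => -[uP fP] Pmax; exists P; split=> // P' uP' fP'.
by apply: Pmax; rewrite in_setE.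
Qed.

Definition best_plan (k : nat) mu : plan := xget (fun=> 0) (optimal_plan k mu).

Definition value (k : nat) mu : R := plan_value k mu (best_plan k mu).

Lemma best_planP k mu : Zmeasure mu -> optimal_plan k mu (best_plan k mu).
Proof. by move=> /(exists_optimal_plan k); exact: xgetPex. Qed.

Lemma valueZ k c mu : 0 <= c -> Zmeasure mu ->
  value k (fun n => c * mu n) = c * value k mu.
Proof.
(* At [c = 0] the feasible sets differ, but every plan has value 0. For [c > 0] the feasible sets
   agree and each optimal plan competes in the other problem. *)
rewrite le_eqVlt => /predU1P[<- mmu|c0 mmu].
  by rewrite /value plan_valueZ// !mul0r.
have mc := Zmeasure_scale (ltW c0) mmu.
have [u1 f1 m1] := best_planP k mmu; have [u2 f2 m2] := best_planP k mc.
have c0' := ltW c0.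
apply/eqP; rewrite /value eq_le; apply/andP; split.
  rewrite plan_valueZ// ler_wpM2l//; apply: m1 => //.
  exact/(plan_feasibleZ _ _ c0 mmu).
by rewrite -plan_valueZ//; apply: m2 => //; exact/(plan_feasibleZ _ _ c0 mmu).
Qed.

Definition plan_cons theta (Q : bool -> plan) : plan := fun i =>
  if i.1.1 is a :: h then Q a (h, i.1.2, i.2) else theta i.1.2 i.2 true.

Lemma plan_cons_now theta Q : is_sstrategy theta ->
  plan_now (plan_cons theta Q) = theta.
Proof.
move=> th; apply/funext => n; apply/funext => y; apply/funext => w.
rewrite /plan_now /plan_cons /= clamp_id; last exact: fin_dist_le1.
by case: w => //; have /fin_dist_bool[_ _] := th n y; lra.
Qed.

Lemma plan_cons_next theta Q a : plan_next (plan_cons theta Q) a = Q a.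
Proof. by apply/funext => -[[h n] y]. Qed.

(** Gluing [theta] to a best continuation plan for each action gives a feasible plan of the longer
    problem with exactly the value on the left. *)
Lemma value_ge k mu theta : Zmeasure mu -> is_sstrategy theta ->
  (forall y, 0 <= slack mu theta y) ->
  reward mu theta + \sum_(a : bool) value k (action_mass mu a theta)
  <= value k.+1 mu.
Proof.
move=> mmu th sl.
pose Q a := best_plan k (action_mass mu a theta).
have bQ a : optimal_plan k (action_mass mu a theta) (Q a).
  exact/best_planP/action_mass_measure.
have [_ _ vmax] := best_planP k.+1 mmu.
apply: le_trans (vmax (plan_cons theta Q) _ _).
- rewrite /= plan_cons_now// lerD2l; apply: ler_sum => a _.
  by rewrite plan_cons_next.
- case=> -[[|a h] n] y; rewrite /plan_cons/=.
    by rewrite in_itv/= fin_dist_le1.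
  by have [uQ _ _] := bQ a; exact: uQ.
- rewrite /= plan_cons_now//; split=> // a.
  by rewrite plan_cons_next; have [] := bQ a.
Qed.

(** What an optimal plan prescribes after an action is feasible for that branch, hence worth at most
    the branch value; [value_ge] gives the other inequality. *)
Lemma value_attained k mu : Zmeasure mu ->
  let theta := plan_now (best_plan k.+1 mu) in
  (forall y, 0 <= slack mu theta y) /\
  reward mu theta + \sum_(a : bool) value k (action_mass mu a theta)
  = value k.+1 mu.
Proof.
move=> mmu theta; have th : is_sstrategy theta by exact: plan_now_strategy.
have [uP [sl fe] _] := best_planP k.+1 mmu; split=> //.
apply/eqP; rewrite eq_le value_ge//= {2}/value/= -/theta lerD2l.
apply: ler_sum => a _.
have [_ _ vmax] := best_planP k (action_mass_measure a mmu th).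
apply: vmax => //; last exact: fe.
by move=> i; exact: uP.
Qed.

(** * Return to normalised summary beliefs *)

Section BellmanEquation.
Context (gam : @sresponse R) (hgam : sbest_response p gam) (T : nat).

Definition bellman_value (t : nat) : (int -> R) -> R := value (T - t).

(** Homogeneity of [value] cancels the probability weight against the division in [supdate]. *)
Lemma bellman_rhs_value t eta theta : (t < T)%N -> Z_dist eta ->
  is_sstrategy theta ->
  bellman_rhs p gam T bellman_value t eta theta
  = reward eta theta
    + \sum_(a : bool) value (T - t.+1) (action_mass eta a theta).
Proof.
move=> tT deta th; have meta := Z_dist_measure deta.
rewrite /bellman_rhs (stax_reward hgam)//; case: ifPn => [_|]; last first.
  (* In the last period no stage remains, and [value 0] is 0. *)
  rewrite -leqNgt => Tt; have -> : (T - t.+1 = 0)%N by apply/eqP; rewrite subn_eq0.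
  by rewrite big1 ?addr0.
congr (_ + _); apply: eq_bigr => a _.
have [am0 asm] := action_mass_measure a meta th.
rewrite saction_probE//; set s := Zsum _.
(* For an action of probability 0 the weight kills the left side; on the right the mass vanishes
   identically, hence equals [0 * eta] and has value 0. *)
have [s0|s0] := eqVneq s 0.
  have z := Zsum_eq0 am0 asm s0.
  rewrite s0 mul0r (_ : action_mass eta a theta = fun n => 0 * eta n).
    by rewrite valueZ// mul0r.
  by apply/funext => n; rewrite z mul0r.
have sge : 0 <= s by exact: Zsum_ge0.
rewrite /bellman_value (_ : supdate p eta a theta =
    fun n => s^-1 * action_mass eta a theta n).
  by rewrite valueZ ?invr_ge0// mulVKf.
by apply/funext => n; rewrite /supdate saction_probE// mulrC.
Qed.

Lemma bellman_value_correct :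
  bellman p gam T bellman_value /\
  attains_bellman p gam T bellman_value
    (fun t eta => plan_now (best_plan (T - t) eta)).
Proof.
have att t eta : (t < T)%N -> Z_dist eta ->
    struthful p eta (plan_now (best_plan (T - t) eta)) /\
    bellman_rhs p gam T bellman_value t eta (plan_now (best_plan (T - t) eta))
    = bellman_value t eta.
  move=> tT deta; have th := plan_now_strategy (best_plan (T - t) eta).
  rewrite bellman_rhs_value// /bellman_value -(subnSK tT).
  rewrite -(subnSK tT) in th.
  by have [sl ->] := value_attained (T - t.+1) (Z_dist_measure deta).
split=> [t tT eta deta|t tT eta deta]; last exact: att.
split.
  by have [? ?] := att t eta tT deta; exists (plan_now (best_plan (T - t) eta)).
move=> _ [theta [th sl] <-]; rewrite bellman_rhs_value// /bellman_value.
by rewrite -(subnSK tT); apply: value_ge => //; exact: Z_dist_measure.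
Qed.

End BellmanEquation.

(** * Reduction of beliefs to summaries *)

Lemma trconsK (X : Type) t (s : t.+1.-tuple X) : trcons (tinit s) (tlast s) = s.
Proof.
apply: val_inj; case: s => -[//|x s] /= sz.
rewrite /thead (tnth_nth x) /tlast (tnth_nth x) /= [RHS]lastI; congr rcons.
by rewrite (last_nth x); case/eqP: sz => ->.
Qed.

Lemma sum_trcons t (F : t.+1.-tuple bool -> R) :
  \sum_m F m = \sum_m \sum_x F (trcons m x).
Proof.
rewrite pair_bigA /= (reindex (fun mx => trcons mx.1 mx.2))//.
exists (fun m => (tinit m, tlast m)) => [[m x] _|m _] /=.
  by rewrite tinit_rcons tlast_rcons.
exact: trconsK.
Qed.

Lemma sum_tuple0 (F : 0.-tuple bool -> R) : \sum_m F m = F [tuple].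
Proof. by rewrite (big_pred1 [tuple])// => m; apply/esym/eqP; exact: tuple0. Qed.

Lemma msum_trcons t (m : t.-tuple bool) x : msum (trcons m x) = msum m + sgn x.
Proof. by rewrite /msum /= -cats1 big_cat big_seq1. Qed.

Section Projection.
Context (t : nat).
Implicit Types (pi : t.-tuple bool -> R) (th : @strategy R t).

(** [theta] is the fibrewise average of [th] under [pi]. The product form avoids a division and
    leaves [theta] free where the summary has no mass. *)
Definition projects pi th theta : Prop := forall n y a,
  summary pi n * theta n y a
  = \sum_(m : t.-tuple bool | msum m == n) pi m * th (trcons m y) a.

Definition denominator pi (a : bool) th : R := \sum_m update_num p pi a th m.

Lemma lift_strategyP theta :
  is_sstrategy theta -> is_strategy (lift_strategy (t := t) theta).
Proof. by move=> sth m; exact: sth. Qed.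

Lemma lift_projects pi theta : projects pi (lift_strategy theta) theta.
Proof.
move=> n y a; rewrite /summary mulr_suml; apply: eq_bigr => m /eqP mn.
by rewrite /lift_strategy tinit_rcons tlast_rcons mn.
Qed.

Lemma exists_projection pi th : fin_dist pi -> is_strategy th ->
  exists2 theta, is_sstrategy theta & projects pi th theta.
Proof.
move=> [pi0 _] sth.
pose s n y a := \sum_(m : t.-tuple bool | msum m == n) pi m * th (trcons m y) a.
have s0 n y a : 0 <= s n y a.
  by apply: sumr_ge0 => m _; apply: mulr_ge0 => //; exact: (sth _).1.
have sE n y : s n y true + s n y false = summary pi n.
  rewrite /s -big_split; apply: eq_bigr => m _ /=.
  by rewrite -mulrDr; have /fin_dist_bool[_ _ ->] := sth (trcons m y); rewrite mulr1.
(* On a fibre of mass 0 any law will do; the uniform one is taken. *)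
exists (fun n y a => if summary pi n == 0 then 1 / 2 else s n y a / summary pi n).
  move=> n y; apply/fin_dist_bool; have [_|n0] := eqVneq (summary pi n) 0.
    by split; lra.
  have sn : 0 <= summary pi n by rewrite -(sE n y) addr_ge0.
  by rewrite -mulrDl sE divff// !divr_ge0.
move=> n y a; have [n0|n0] := eqVneq (summary pi n) 0; last by rewrite mulrC divfK.
rewrite n0 mul0r big1// => m mn.
by rewrite (psumr_eq0P _ n0)// mul0r.
Qed.

Lemma summary_dist pi : fin_dist pi -> Z_dist (summary pi).
Proof.
move=> [pi0 pi1]; apply/Z_distP; split.
- by move=> n; exact: sumr_ge0.
- exact: Zsummable_fibers.
- by rewrite (Zsum_fibers (F := pi) (k := @msum t)).
Qed.

Lemma Zsum_summary pi (h : int -> R) :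
  Zsum (fun n => summary pi n * h n) = \sum_m pi m * h (msum m).
Proof.
apply: (Zsum_fibers (k := @msum t)) => n.
by rewrite mulr_suml; apply: eq_bigr => m /eqP ->.
Qed.

(** A weight that sees the history only through its sum is constant on each fibre, so averaging
    passes through it. The tax, the constraint and the transition all use weights of this kind. *)
Lemma projects_weighted pi th theta (h : int -> R) n y a :
  projects pi th theta ->
  summary pi n * h n * theta n y a
  = \sum_(m : t.-tuple bool | msum m == n) pi m * h (msum m) * th (trcons m y) a.
Proof.
move=> pth; rewrite mulrAC pth mulr_suml; apply: eq_bigr => m /eqP ->.
by rewrite mulrAC.
Qed.

Lemma tax_reward (gam : @response R) pi th theta :
  best_response p gam -> fin_dist pi -> projects pi th theta ->
  tax p gam pi th = reward (summary pi) theta.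
Proof.
move=> hgam dpi pth.
rewrite /tax /reward -sumrB; apply: eq_bigr => y _.
have [gd gmax] := hgam t pi y dpi.
have peakE w : peak (summary pi) y w = Qy p y w * \sum_m q p w (msum m) * pi m.
  rewrite /peak Zsum_summary; congr (_ * _); apply: eq_bigr => m _.
  by rewrite mulrC.
rewrite -(sum_argmax (g := gam t pi y))//; last first.
  by move=> a b /gmax; rewrite !peakE; exact.
rewrite -sumrB; apply: eq_bigr => w _.
rewrite (Zsum_fibers (k := @msum t)
  (F := fun m => Qy p y w * q p w (msum m) * pi m * th (trcons m y) w)).
  rewrite peakE !mulr_sumr -sumrB; apply: eq_bigr => m _; ring.
move=> n; rewrite (mulrC (Qy p y w)) -(mulrA (summary pi n)).
rewrite (projects_weighted (fun n => Qy p y w * q p w n) _ _ _ pth).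
by apply: eq_bigr => m _; rewrite (mulrC (pi m)).
Qed.

Lemma truthful_slack pi th theta : projects pi th theta ->
  truthful p pi th <-> forall y, 0 <= slack (summary pi) theta y.
Proof.
move=> pth.
have sE y : slack (summary pi) theta y = \sum_w \sum_(m : t.-tuple bool)
    Qy p y w * q p w (msum m) * pi m * (th (trcons m y) w - th (trcons m (~~ y)) w).
  rewrite exchange_big; apply: (Zsum_fibers (k := @msum t)) => n.
  rewrite exchange_big; apply: eq_bigr => w _.
  rewrite mulrBr (mulrC (Qy p y w)) -(mulrA (summary pi n)).
  rewrite !(projects_weighted (fun n => Qy p y w * q p w n) _ _ _ pth) -sumrB.
  by apply: eq_bigr => m _; rewrite -mulrBr (mulrC (pi m)).
by split=> tr y; have := tr y; rewrite sE.
Qed.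

Lemma action_mass_projects pi th theta a n : projects pi th theta ->
  action_mass (summary pi) a theta n
  = \sum_(m : t.+1.-tuple bool | msum m == n) update_num p pi a th m.
Proof.
move=> pth; rewrite /action_mass [RHS]big_mkcond sum_trcons.
rewrite exchange_big [RHS]exchange_big; apply: eq_bigr => x _ /=.
under [RHS]eq_bigr do rewrite msum_trcons.
(* Fixing the last report [x] turns the fibre over [n] into the fibre over [n - sgn x], the shift in
   [action_mass]. *)
rewrite (eq_bigr (fun m => if msum m == n - sgn x
   then update_num p pi a th (trcons m x) else 0)); last first.
  by move=> m _; rewrite -(can2_eq (addrK (sgn x)) (subrK (sgn x))).
rewrite -big_mkcond /= /update_num [RHS]exchange_big; apply: eq_bigr => w _.
rewrite -(mulrA (summary pi _)).
rewrite (projects_weighted (fun n => q p w n * Qy p x w) _ _ _ pth).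
apply: eq_bigr => m _; rewrite tinit_rcons tlast_rcons; ring.
Qed.

Lemma saction_prob_projects pi th theta a :
  fin_dist pi -> is_sstrategy theta -> projects pi th theta ->
  saction_prob p (summary pi) theta a = denominator pi a th.
Proof.
move=> dpi sth pth; rewrite saction_probE//; last first.
  exact/Z_dist_measure/summary_dist.
apply: (Zsum_fibers (k := @msum t.+1)) => n; exact: action_mass_projects.
Qed.

(** Restricted to actions of positive probability, since otherwise the belief is set by the
    convention while [supdate] is the zero function. *)
Lemma summary_update (conv : @convention R) pi th theta a :
  fin_dist pi -> is_sstrategy theta -> projects pi th theta ->
  denominator pi a th != 0 ->
  summary (update p conv pi a th) = supdate p (summary pi) a theta.
Proof.
move=> dpi sth pth d0; apply/funext => n.
rewrite /supdate -/(action_mass (summary pi) a theta n).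
rewrite (saction_prob_projects _ dpi sth pth) (action_mass_projects _ _ pth).
rewrite mulr_suml; apply: eq_bigr => m _.
by rewrite /update -/(denominator pi a th) (negbTE d0).
Qed.

Lemma update_num_ge0 pi th a m : fin_dist pi -> is_strategy th ->
  0 <= update_num p pi a th m.
Proof.
move=> [pi0 _] sth; apply: sumr_ge0 => w _.
have /andP[q0 _] := q_bounds w (msum (tinit m)).
have /andP[Q0 _] := Qy_bounds (tlast m) w.
by rewrite !mulr_ge0//; exact: (sth _).1.
Qed.

Lemma update_dist (conv : @convention R) pi th a :
  is_convention conv -> fin_dist pi -> is_strategy th ->
  fin_dist (update p conv pi a th).
Proof.
move=> hconv dpi sth; rewrite /update -/(denominator pi a th).
case: eqVneq => [_|d0]; first exact: hconv.
split=> [m|]; last by rewrite -mulr_suml divff.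
by rewrite divr_ge0 ?update_num_ge0// sumr_ge0// => *; exact: update_num_ge0.
Qed.

Lemma sum_denominator pi th : fin_dist pi -> is_strategy th ->
  \sum_a denominator pi a th = 1.
Proof.
move=> [_ pi1] sth; rewrite exchange_big sum_trcons /= -[RHS]pi1.
apply: eq_bigr => m _.
transitivity (\sum_x \sum_w q p w (msum m) * pi m * Qy p x w).
  apply: eq_bigr => x _; rewrite exchange_big /=; apply: eq_bigr => w _.
  rewrite -mulr_sumr tinit_rcons tlast_rcons.
  by have [_ ->] := sth (trcons m x); rewrite mulr1.
rewrite exchange_big /=.
under eq_bigr do rewrite -mulr_sumr Qy_sum mulr1.
by rewrite -mulr_suml q_sum mul1r.
Qed.

End Projection.

(** * Verification: the Bellman value bounds the objective and is attained *)

Section Verification.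
Context (T : nat) (conv : @convention R) (hconv : is_convention conv).
Implicit Types (phi : @policy R).

(** Feasibility says nothing about periods from [T] on, so validity is tracked up to a given
    time. *)
Definition strategies_below phi (t : nat) : Prop :=
  forall s, (s < t)%N -> forall a : s.-tuple bool, is_strategy (phi s a).

Lemma belief_dist phi t (a : t.-tuple bool) :
  strategies_below phi t -> fin_dist (belief p conv phi a).
Proof.
elim: t a => [|t IH] a sphi.
  by split=> //; rewrite sum_tuple0.
apply: update_dist => //; last exact: sphi.
by apply: IH => s st; apply: sphi; exact: ltnW.
Qed.

Definition history_prob phi t (a : t.-tuple bool) : R :=
  \sum_w \sum_m law p phi w m a.

Definition action_prob phi t (a : t.-tuple bool) (x : bool) : R :=
  denominator (belief p conv phi a) x (phi t a).

(** Given the actions, the reports have law [belief], and given the reports the state has law [q].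
    By induction: [q_bayes] moves the new report into the argument of [q] and leaves the normalising
    factor of the update. *)
Lemma law_belief phi t (a : t.-tuple bool) : strategies_below phi t ->
  forall w m, law p phi w m a
    = q p w (msum m) * history_prob phi a * belief p conv phi a m.
Proof.
elim: t a => [|t IH] a sphi w m.
  rewrite /history_prob /= big_bool/= !sum_tuple0 mulr1.
  have -> : 1 / 2 + 1 / 2 = 1 :> R by lra.
  rewrite [m]tuple0 /msum big_nil /q expr0z mulr1.
  by case: w.
have sphi' : strategies_below phi t by move=> s st; apply: sphi; exact: ltnW.
pose a0 := tinit a; pose pi := belief p conv phi a0; pose th := phi t a0.
have dpi : fin_dist pi by exact: belief_dist.
have sth : is_strategy th by exact: sphi.
have lawE v m' : law p phi v m' a
    = q p v (msum m') * (history_prob phi a0 * update_num p pi (tlast a) th m').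
  rewrite /= IH// -/a0 -/pi -/th.
  have -> : msum m' = msum (tinit m') + sgn (tlast m').
    by rewrite -msum_trcons trconsK.
  transitivity (q p v (msum (tinit m')) * Qy p (tlast m') v *
    (history_prob phi a0 * pi (tinit m') * th m' (tlast a))); first by ring.
  rewrite q_bayes -!mulrA; congr (_ * _).
  rewrite /update_num mulr_suml mulr_sumr; apply: eq_bigr => u _; ring.
have probE : history_prob phi a
    = history_prob phi a0 * denominator pi (tlast a) th.
  rewrite {1}/history_prob exchange_big mulr_sumr; apply: eq_bigr => m' _.
  under eq_bigr do rewrite lawE.
  by rewrite -mulr_suml q_sum mul1r.
rewrite lawE probE /= -/a0 -/pi -/th /update -/(denominator pi (tlast a) th).
(* With a zero denominator all the nonnegative terms [update_num] vanish, so both sides are 0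
   whatever the convention returns. *)
have [d0|d0] := eqVneq (denominator pi (tlast a) th) 0.
  rewrite d0 (psumr_eq0P _ d0)//; last by move=> *; exact: update_num_ge0.
  by rewrite !mulr0 mul0r.
by rewrite -!mulrA [_ / _]mulrC mulVKf.
Qed.

Lemma history_prob_trcons phi t (a : t.-tuple bool) x :
  strategies_below phi t ->
  history_prob phi (trcons a x) = history_prob phi a * action_prob phi a x.
Proof.
move=> sphi; rewrite {1}/history_prob exchange_big mulr_sumr.
apply: eq_bigr => m _ /=; rewrite tinit_rcons tlast_rcons.
rewrite /update_num mulr_sumr; apply: eq_bigr => w _.
rewrite law_belief//; ring.
Qed.

Lemma history_prob_ge0 phi t (a : t.-tuple bool) :
  strategies_below phi t -> 0 <= history_prob phi a.
Proof.
elim: t a => [|t IH] a sphi.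
  by rewrite /history_prob /= big_bool/= !sum_tuple0; lra.
have sphi' : strategies_below phi t by move=> s st; apply: sphi; exact: ltnW.
rewrite -(trconsK a) history_prob_trcons// mulr_ge0 ?IH//.
apply: sumr_ge0 => m _; apply: update_num_ge0; last exact: sphi.
exact: belief_dist.
Qed.

(** * Telescoping of expected taxes along action histories *)

Section Telescope.
Context (gam : @response R) (U : forall t, t.-tuple bool -> R).

(** Expected tax collected before [t] plus a candidate value-to-go [U]: it starts at [U [tuple]]
    and, if [U] vanishes at [T], ends at the objective. *)
Definition partial_value phi t : R :=
  \sum_(a : t.-tuple bool)
    history_prob phi a * (total_tax p gam conv phi a + U a).

Definition stage_value phi t (a : t.-tuple bool) : R :=
  tax p gam (belief p conv phi a) (phi t a)
  + \sum_x action_prob phi a x * U (trcons a x).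

(** Conditioning on the last action turns [U] at [t.+1] into the stage value at [t], so comparing
    stage values with [U] makes the partial values monotone or constant in time. *)
Lemma partial_valueS phi t : strategies_below phi t.+1 ->
  partial_value phi t.+1
  = \sum_(a : t.-tuple bool)
      history_prob phi a * (total_tax p gam conv phi a + stage_value phi a).
Proof.
move=> sphi; rewrite /partial_value sum_trcons; apply: eq_bigr => a _.
have sphi' : strategies_below phi t by move=> s st; apply: sphi; exact: ltnW.
under eq_bigr do rewrite history_prob_trcons// -mulrA /= tinit_rcons.
rewrite -mulr_sumr; congr (_ * _).
under eq_bigr do rewrite mulrDr.
rewrite big_split /= -mulr_suml sum_denominator ?mul1r ?addrA//.
- exact: belief_dist.
- exact: sphi.
Qed.

Lemma partial_value0 phi : partial_value phi 0 = U [tuple].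
Proof.
rewrite /partial_value sum_tuple0 /= add0r /history_prob /= big_bool/=.
rewrite !sum_tuple0; lra.
Qed.

Lemma partial_value_le phi t : strategies_below phi t ->
  (forall s, (s < t)%N -> forall a : s.-tuple bool, stage_value phi a <= U a) ->
  partial_value phi t <= U [tuple].
Proof.
elim: t => [|t IH] sphi sU; first by rewrite partial_value0.
have sphi' : strategies_below phi t by move=> s st; apply: sphi; exact: ltnW.
rewrite partial_valueS//; apply: le_trans (IH sphi' _); last first.
  by move=> s st; apply: sU; exact: ltnW.
apply: ler_sum => a _; rewrite ler_wpM2l ?history_prob_ge0// lerD2l; exact: sU.
Qed.

Lemma partial_value_eq phi t : strategies_below phi t ->
  (forall s, (s < t)%N -> forall a : s.-tuple bool, stage_value phi a = U a) ->
  partial_value phi t = U [tuple].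
Proof.
elim: t => [|t IH] sphi sU; first by rewrite partial_value0.
have sphi' : strategies_below phi t by move=> s st; apply: sphi; exact: ltnW.
rewrite partial_valueS// -(IH sphi'); last by move=> s st; apply: sU; exact: ltnW.
by apply: eq_bigr => a _; rewrite sU.
Qed.

Lemma partial_value_objective phi : (forall a : T.-tuple bool, U a = 0) ->
  partial_value phi T = objective p gam conv T phi.
Proof.
move=> U0; rewrite /objective.
under [RHS]eq_bigr do rewrite exchange_big.
rewrite exchange_big; apply: eq_bigr => a _ /=.
rewrite U0 addr0 /history_prob mulr_suml; apply: eq_bigr => w _.
by rewrite mulr_suml.
Qed.

End Telescope.

Context (gam : @response R) (hgam : best_response p gam)
  (sgam : @sresponse R) (hsgam : sbest_response p sgam)
  (V : nat -> (int -> R) -> R).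

(** [V] is constrained only for [t < T]; the cut-off supplies the terminal value 0. *)
Definition continuation phi t (a : t.-tuple bool) : R :=
  if (t < T)%N then V t (summary (belief p conv phi a)) else 0.

(** The stage value of an arbitrary policy is the Bellman expression at its projection; branches of
    probability 0, where the beliefs may disagree, carry weight 0. *)
Lemma stage_value_bellman phi t (a : t.-tuple bool) theta :
  (t < T)%N -> strategies_below phi t.+1 -> is_sstrategy theta ->
  projects (belief p conv phi a) (phi t a) theta ->
  stage_value gam (@continuation phi) phi a
  = bellman_rhs p sgam T V t (summary (belief p conv phi a)) theta.
Proof.
move=> tT sphi sth pth.
have sphi' : strategies_below phi t by move=> s st; apply: sphi; exact: ltnW.
have dpi : fin_dist (belief p conv phi a) by exact: belief_dist.
rewrite /bellman_rhs (stax_reward hsgam)//; last exact: summary_dist.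
rewrite /stage_value (tax_reward hgam dpi pth) /continuation.
case: ifP => _; last by rewrite big1 ?addr0// => x _; rewrite mulr0.
congr (_ + _); apply: eq_bigr => x _.
rewrite (saction_prob_projects _ dpi sth pth) /action_prob.
have [->|d0] := eqVneq (denominator (belief p conv phi a) x (phi t a)) 0.
  by rewrite !mul0r.
by rewrite /= tinit_rcons tlast_rcons (summary_update conv dpi sth pth d0).
Qed.

Lemma objective_le phi : bellman p sgam T V -> feasible p conv T phi ->
  objective p gam conv T phi <= continuation phi [tuple].
Proof.
move=> hV feas; have sphi : strategies_below phi T.
  by move=> s sT a; have [] := feas s sT a.
rewrite -(partial_value_objective gam (U := @continuation phi)); last first.
  by move=> a; rewrite /continuation ltnn.
apply: partial_value_le => // t tT a.
have sphit : strategies_below phi t.+1.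
  by move=> s st; apply: sphi; exact: leq_trans tT.
have dpi : fin_dist (belief p conv phi a).
  by apply: belief_dist => s st; apply: sphi; exact: ltn_trans tT.
have [sth tr] := feas t tT a.
have [theta stheta pth] := exists_projection dpi sth.
rewrite (stage_value_bellman tT sphit stheta pth) /continuation tT.
have [_ ub] := hV t tT _ (summary_dist dpi); apply: ub; exists theta => //.
by split=> //; apply/(truthful_slack pth).
Qed.

(** [phis] is controlled only at genuine distributions, so validity at time [t] needs the belief
    there to be one, which in turn needs validity at all earlier times. *)
Lemma induced_strategies (phis : @spolicy R) : attains_bellman p sgam T V phis ->
  forall t, (t <= T)%N -> strategies_below (induced_policy p conv phis) t.
Proof.
move=> att; elim=> [//|t IH] tT s; rewrite ltnS leq_eqVlt => /predU1P[->|st] a.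
  have deta : Z_dist (summary (induced_belief p conv phis a)).
    by apply: summary_dist; rewrite -induced_beliefE; exact/belief_dist/IH/ltnW.
  by have [[sth _] _] := att t tT _ deta; exact: lift_strategyP.
exact: IH (ltnW tT) s st a.
Qed.

Lemma induced_feasible (phis : @spolicy R) : attains_bellman p sgam T V phis ->
  feasible p conv T (induced_policy p conv phis).
Proof.
move=> att t tT a; split; first exact: (induced_strategies att (leqnn T)).
have dpi : fin_dist (belief p conv (induced_policy p conv phis) a).
  exact/belief_dist/(induced_strategies att)/ltnW.
have [[_ sl] _] := att t tT _ (summary_dist dpi).
rewrite /induced_policy -induced_beliefE.
by apply/(truthful_slack (lift_projects _ _)).
Qed.

Lemma objective_induced (phis : @spolicy R) : attains_bellman p sgam T V phis ->
  objective p gam conv T (induced_policy p conv phis)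
  = continuation (induced_policy p conv phis) [tuple].
Proof.
move=> att; set phi := induced_policy p conv phis.
have sphi := induced_strategies att (leqnn T).
rewrite -(partial_value_objective gam (U := @continuation phi)); last first.
  by move=> a; rewrite /continuation ltnn.
apply: partial_value_eq => // t tT a.
have dpi : fin_dist (belief p conv phi a).
  exact/belief_dist/(induced_strategies att)/ltnW.
have [[sth _] rhsE] := att t tT _ (summary_dist dpi).
rewrite (stage_value_bellman tT (induced_strategies att tT) sth).
  by rewrite rhsE /continuation tT.
rewrite /phi /induced_policy -induced_beliefE; exact: lift_projects.
Qed.

Lemma induced_optimal (phis : @spolicy R) :
  bellman p sgam T V -> attains_bellman p sgam T V phis ->
  optimal p gam conv T (induced_policy p conv phis).
Proof.
move=> hV att; split; first exact: induced_feasible.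
(* The initial belief does not depend on the policy, so the upper bound for [phi'] and the value
   attained are the same number. *)
by move=> phi' /(objective_le hV); rewrite objective_induced.
Qed.

End Verification.

End SummaryModel.

Theorem theorem2 (R : realType) (p : R) (hp0 : 0 < p) (hp1 : p < 1 / 2)
    (T : nat) (hT : (0 < T)%N)
    (conv : @convention R) (hconv : is_convention conv)
    (gam : @response R)
    (hgam : best_response p gam)
    (sgam : @sresponse R)
    (hsgam : sbest_response p sgam) :
  [/\ exists phis : @spolicy R,
        is_spolicy T phis /\ optimal p gam conv T (induced_policy p conv phis),
      exists (V : nat -> (int -> R) -> R) (phis : @spolicy R),
        bellman p sgam T V /\ attains_bellman p sgam T V phis
    & forall (V : nat -> (int -> R) -> R) (phis : @spolicy R),
        bellman p sgam T V -> attains_bellman p sgam T V phis ->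
        optimal p gam conv T (induced_policy p conv phis)].
Proof.
have [bV aV] := bellman_value_correct hp0 hp1 hsgam T.
have opt := induced_optimal hp0 hp1 hconv hgam hsgam.
split; last exact: opt.
- exists (fun t eta => plan_now (best_plan p (T - t) eta)).
  split; last exact: opt bV aV.
  by move=> t tT eta deta; have [[]] := aV t tT eta deta.
- by exists (bellman_value p T), (fun t eta => plan_now (best_plan p (T - t) eta)).
Qed.
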